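(* Let $(V,P)$ be a mixing Markov chain, for each $n\ge 1$ let $C_n$ be the coalescence time of the coalescing random walk on the associated $n$-block chain $(V_n,P_n)$, and let $L(V,P)=-\log\lambda$. Then for every $\epsilon>0$ there exist $\delta>0$ and $N\in\mathbb{N}$ such that for all $n\ge N$, $$\mathbb{P}\left(\left|\frac{1}{n}\log C_n-L(V,P)\right|>\epsilon\right)\le e^{-\delta n}.$$
   Context: A Markov chain $(V,P)$ consists of a finite set $V$ and a stochastic transition matrix $P$ indexed by $V$; it is mixing if $P^k>0$ entrywise for some $k\ge1$. Let $\pi$ be its unique stationary distribution. For a word $u=u_1\cdots u_n\in V^n$ put $\mu(u)=\pi(u_1)\prod_{j=1}^{n-1}P(u_j,u_{j+1})$. The $n$-block chain $(V_n,P_n)$ associated to $(V,P)$ has state space $V_n=\{u\in V^n:\mu(u)>0\}$ and transition matrix $P_n(u,v)=P(u_n,v_n)$ if $u_2\cdots u_n=v_1\cdots v_{n-1}$, and $P_n(u,v)=0$ otherwise. It is again mixing. Coalescing random walk on $(V_n,P_n)$: initially one walker is placed on each state of $V_n$; the walkers move independently in discrete time according to $P_n$ until two or more of them occupy the same state simultaneously, at which point these coalesce and move together thereafter according to $P_n$. $C_n$ is the first time at which only one walker (cluster) remains. Times are counted starting from $1$, i.e. the initial configuration is the configuration at time $1$ (so $C_n\ge1$, and $C_n=1$ if $|V_n|=1$). $\mathbb{P}$ is the law of this process. Let $Q$ be the $|V|\times|V|$ matrix with $Q(u,v)=P(u,v)^2$, let $\lambda$ be its Perron eigenvalue (spectral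 radius), and $L(V,P)=-\log\lambda$ (natural logarithm). *)

(* Defs.v *)
From HB Require Import structures.
From mathcomp Require Import all_boot all_order all_algebra.
From mathcomp Require Import all_classical all_reals all_analysis.
From mathcomp.real_closed Require Import complex.

Set Implicit Arguments.
Unset Strict Implicit.
Unset Printing Implicit Defensive.

Import Order.TTheory GRing.Theory Num.Theory.

Local Open Scope ring_scope.

Section Chains.
Context {R : realType} {S : finType}.
Implicit Types (K : S -> S -> R) (p : S -> R).

Definition stochastic K : Prop :=
  (forall u v, 0 <= K u v) /\ (forall u, \sum_v K u v = 1).

Definition kernel_mx K : 'M[R]_#|S| :=
  \matrix_(i, j) K (enum_val i) (enum_val j).

Definition mixing K : Prop :=
  exists2 k : nat, (1 <= k)%N & forall i j, 0 < (kernel_mx K ^+ k) i j.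

Definition stationary K p : Prop :=
  [/\ forall u, 0 <= p u, \sum_u p u = 1 & forall v, \sum_u p u * K u v = p v].

End Chains.

(* Eigenvalues are taken over R[i]; the set is finite, so [sup] is a maximum
   as soon as m > 0. *)
Definition spectral_radius {R : realType} {m : nat} (A : 'M[R]_m) : R :=
  sup [set ComplexField.Normc.normc z
      | z in [set z : R[i] | eigenvalue (map_mx (real_complex R) A) z]]%classic.

Definition Lexp {R : realType} {V : finType} (P : V -> V -> R) : R :=
  - ln (spectral_radius (kernel_mx (fun u v => P u v ^+ 2))).

Section Blocks.
Context {R : realType} {V : finType}.
Variables (P : V -> V -> R) (p : V -> R).

Definition mu (u : seq V) : R :=
  if u is x :: s then p x * \prod_(q <- pairmap P x s) q else 1.

Definition block (n : nat) : finType := {u : n.-tuple V | 0 < mu u}.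

(* [belast y t] is the word [y :: t] without its last letter. *)
Definition block_kernel (n : nat) (u v : block n) : R :=
  match tval (val u), tval (val v) with
  | x :: s, y :: t => if s == belast y t then P (last x s) (last y t) else 0
  | _, _ => 0
  end.

End Blocks.

Section CoalescingWalk.
Context {R : realType} {S : finType}.
Variable K : S -> S -> R.

(* [x a] is the position of the walker started at [a], and [codom x] is the
   list of occupied states. *)
Definition config : Type := {ffun S -> S}.

(* All the walkers at an occupied state [s] jump to a common [t] drawn from
   [K s], independently for distinct [s].  For [s] occupied at most one [t]
   satisfies the condition; none does (and the probability is 0) when [y]
   separates walkers that [x] has at the same place. *)
Definition coalescing_step (x y : config) : R :=
  \prod_(s in codom x)
    \sum_(t | [forall a, (x a == s) ==> (y a == t)]) K s t.

(* [X t] is the configuration at time [t] for t >= 1; [X 0] plays no role. *)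
Definition coalescing_random_walk d (T : measurableType d)
    (Pr : probability T R) (X : nat -> T -> config) : Prop :=
  (forall t x, (1 <= t)%N -> measurable [set w | X t w = x]%classic) /\
  (forall (k : nat) (x : nat -> config), (1 <= k)%N ->
    Pr [set w | forall t, (1 <= t <= k)%N -> X t w = x t]%classic =
    ((x 1%N == [ffun a => a])%:R *
      \prod_(1 <= t < k) coalescing_step (x t) (x t.+1))%:E).

(* Equal to +oo when the walkers never all meet. *)
Definition coalescence_time T (X : nat -> T -> config) (w : T) : \bar R :=
  ereal_inf [set t%:R%:E
            | t in [set t : nat | (1 <= t)%N /\ #|codom (X t w)| = 1%N]]%classic.

End CoalescingWalk.

(* Main.v *)
(* Two walkers on the n-block chain meet when their last n letters agree.  Up to
   constants, two independent P-chains write the same n letters with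
   probability lam ^ n, where lam is the Perron eigenvalue of the entrywise
   square of P.

   Lower tail: walkers started at two words with distinct last letters must
   write n common letters before meeting, so by a union bound they meet before
   time t with probability O(t lam ^ n).

   Upper tail: from any two words, the last letters agree after k steps with
   probability bounded below, and the next n letters then agree with
   probability of order lam ^ n.  Hence a pair stays apart until time t with
   probability at most exp (- c lam ^ n t / (n + k)), which for
   t = lam ^ (-n) e ^ (n eps) beats the exponential number of pairs. *)

Require Import Defs.
From HB Require Import structures.
From mathcomp Require Import all_boot all_order all_algebra.
From mathcomp Require Import all_classical all_reals all_analysis.
From mathcomp.real_closed Require Import complex.
From mathcomp Require Import lra ring zify.

Set Implicit Arguments.
Unset Strict Implicit.
Unset Printing Implicit Defensive.

Import Order.TTheory GRing.Theory Num.Theory.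
Import numFieldNormedType.Exports.
Local Open Scope ring_scope.

(** * Pairs of coalescing walkers *)

Section PairDynamics.
Context {R : realType} {S : finType}.
Variable K : S -> S -> R.

Definition pair_op (h : S -> S -> R) (s s' : S) : R :=
  \sum_t \sum_t' K s t * K s' t' * h t t'.

(* Probability that the walk started at [x] satisfies [F j] after [j] steps,
   for every [j <= m]. *)
Fixpoint path_weight (F : nat -> pred (config (S := S))) m (x : config) : R :=
  if m is m'.+1 then
    (F 0%N x)%:R *
      \sum_y coalescing_step K x y * path_weight (fun j => F j.+1) m' y
  else (F 0%N x)%:R.

(* Probability that walkers started at [s] and [s'] have not met within [m]
   steps; [agree] is the probability that two independent chains, which are
   allowed to cross and separate, are at the same state at time [m]. *)
Fixpoint unmet m (s s' : S) : R :=
  (s != s')%:R * (if m is m'.+1 then pair_op (unmet m') s s' else 1).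

Definition agree m : S -> S -> R :=
  iter m pair_op (fun s s' => (s == s')%:R).

Lemma unmet_diag m s : unmet m s s = 0.
Proof. by case: m => [|m] /=; rewrite eqxx mul0r. Qed.

Hypothesis hK : stochastic K.

(* One step of the walk applies a random map [g], whose values are independent
   with law [K s], to the positions of all walkers. *)
Lemma sum_coalescing_step (x : config) (f : config -> R) :
  \sum_y coalescing_step K x y * f y =
  \sum_(g : {ffun S -> S}) (\prod_s K s (g s)) * f [ffun a => g (x a)].
Proof.
have E y : coalescing_step K x y =
    \sum_(g : {ffun S -> S} | [forall a, y a == g (x a)]) \prod_s K s (g s).
  transitivity
    (\prod_s \sum_(t | [forall a, (x a == s) ==> (y a == t)]) K s t).
    (* An unoccupied state imposes no constraint on its image, so its factor is a full row sum of
       [K], equal to 1. *)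
    rewrite [RHS](bigID (mem (codom x))) /= [X in _ = _ * X]big1 ?mulr1 //.
    move=> s sx; rewrite -(hK.2 s); apply: eq_bigl => t.
    apply/forallP => a; apply/implyP => /eqP xa.
    by rewrite -xa codom_f in sx.
  rewrite bigA_distr_big_dep; apply: eq_bigl => g.
  apply/familyP/forallP => [gP a|gP s].
    by have /forallP/(_ a) := gP (x a); rewrite eqxx.
  by apply/forallP => a; apply/implyP => /eqP <-; exact: gP.
under eq_bigr do rewrite E big_distrl /=.
rewrite (exchange_big_dep xpredT) //=; apply: eq_bigr => g _.
rewrite (big_pred1 [ffun a => g (x a)]) // => y /=.
apply/forallP/eqP => [gP|-> a]; last by rewrite ffunE.
by apply/ffunP => a; rewrite ffunE; apply/eqP.
Qed.

(** Under the product law of the random map, the values at two distinct states are independent and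
    the other coordinates integrate to 1. *)
Lemma sum_random_map_pair (s1 s2 : S) (h : S -> S -> R) : s1 != s2 ->
  \sum_(g : {ffun S -> S}) (\prod_s K s (g s)) * h (g s1) (g s2) =
  pair_op h s1 s2.
Proof.
move=> s12; rewrite (partition_big (fun g : {ffun S -> S} => g s1) xpredT) //=.
apply: eq_bigr => t _.
rewrite (partition_big (fun g : {ffun S -> S} => g s2) xpredT) //=.
apply: eq_bigr => t' _.
(* Writing the event [g s1 = t], [g s2 = t'] as one constraint per state makes the sum over maps a
   product of sums. *)
pose Q s u := ((s == s1) ==> (u == t)) && ((s == s2) ==> (u == t')).
transitivity ((\sum_(g in family Q) \prod_s K s (g s)) * h t t').
  rewrite big_distrl /=; apply: congr_big => // g.
    apply/andP/familyP => [[/eqP g1 /eqP g2] s|gQ].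
      rewrite unfold_in /Q; apply/andP; split; apply/implyP => /eqP ->.
        by rewrite g1.
      by rewrite g2.
    have := gQ s1; have := gQ s2; rewrite !unfold_in /Q !eqxx /=.
    by rewrite andbC => /andP[-> _] /andP[->].
  by move=> /andP[/eqP -> /eqP ->].
have s21 : s2 != s1 by rewrite eq_sym.
rewrite -bigA_distr_big_dep (bigD1 s1) //= [X in _ * X * _ = _](bigD1 s2) //=.
rewrite [X in _ * (_ * X)]big1 ?mulr1; last first.
  move=> s /andP[/negbTE n1 /negbTE n2]; rewrite -(hK.2 s).
  by apply: eq_bigl => u; rewrite /Q n1 n2.
congr (_ * _ * _).
  by rewrite (big_pred1 t) // => u; rewrite /Q eqxx (negbTE s12) andbT.
by rewrite (big_pred1 t') // => u; rewrite /Q eqxx eq_sym (negbTE s12).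
Qed.

(* Walkers that have met stay together, so it is irrelevant whether separation
   is tested at all times or at the last one only. *)
Lemma path_weight_unmet a b m (F : nat -> pred config) (x : config) :
  (forall y : config, F m y = (y a != y b)) ->
  (forall j (y : config), (j < m)%N -> y a != y b -> F j y) ->
  path_weight F m x = unmet m (x a) (x b).
Proof.
elim: m F x => [|m IH] F x Fm Fj /=; first by rewrite Fm mulr1.
have {}IH y : path_weight (fun j => F j.+1) m y = unmet m (y a) (y b).
  by apply: IH => // j z jm; exact: Fj.
under eq_bigr do rewrite IH.
rewrite sum_coalescing_step; under eq_bigr do rewrite !ffunE.
(* If the walkers already coincide, a common map keeps them together, so the final test [F m]
   fails. *)
have [xab|xab] := eqVneq (x a) (x b).
  by rewrite mul0r big1 ?mulr0 // => g _; rewrite xab unmet_diag mulr0.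
by rewrite Fj // sum_random_map_pair // xab.
Qed.

End PairDynamics.

(** * Bounds on non-meeting probabilities through independent chains *)

Section PairEstimates.
Context {R : realType} {S : finType}.
Variable K : S -> S -> R.
Hypothesis hK : stochastic K.

Lemma ler_pair_op (h h' : S -> S -> R) s s' :
  (forall t t', h t t' <= h' t t') -> pair_op K h s s' <= pair_op K h' s s'.
Proof.
move=> hh'; apply: ler_sum => t _; apply: ler_sum => t' _.
by apply: ler_wpM2l => //; apply: mulr_ge0; apply: hK.1.
Qed.

Lemma pair_op_const c s s' : pair_op K (fun _ _ => c) s s' = c.
Proof.
rewrite /pair_op -[RHS]mul1r -(hK.2 s) big_distrl; apply: eq_bigr => t _ /=.
by rewrite -big_distrl -big_distrr /= hK.2 mulr1.
Qed.

Lemma pair_opB (h h' : S -> S -> R) s s' :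
  pair_op K (fun t t' => h t t' - h' t t') s s' =
  pair_op K h s s' - pair_op K h' s s'.
Proof.
rewrite /pair_op -sumrB; apply: eq_bigr => t _.
by rewrite -sumrB; apply: eq_bigr => t' _; rewrite mulrBr.
Qed.

Lemma pair_op_sum (I : finType) (h : I -> S -> S -> R) s s' :
  pair_op K (fun t t' => \sum_i h i t t') s s' = \sum_i pair_op K (h i) s s'.
Proof.
rewrite /pair_op [RHS]exchange_big; apply: eq_bigr => t _ /=.
rewrite [RHS]exchange_big; apply: eq_bigr => t' _ /=.
by rewrite mulr_sumr.
Qed.

Lemma pair_opZ c (h : S -> S -> R) s s' :
  pair_op K (fun t t' => c * h t t') s s' = c * pair_op K h s s'.
Proof.
rewrite /pair_op mulr_sumr; apply: eq_bigr => t _.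
by rewrite mulr_sumr; apply: eq_bigr => t' _; rewrite mulrCA.
Qed.

Lemma agree_le1 m s s' : agree K m s s' <= 1.
Proof.
elim: m s s' => [|m IH] s s' /=; first by case: eqP.
by rewrite -[leRHS](pair_op_const 1 s s'); apply: ler_pair_op.
Qed.

(** Independent chains that agree at time [m] have met by then. *)
Lemma unmet_le1Bagree m s s' : unmet K m s s' <= 1 - agree K m s s'.
Proof.
elim: m s s' => [|m IH] s s'.
  by rewrite /agree /= mulr1; case: eqP => _ /=; lra.
have [->|ss'] := eqVneq s s'; first by rewrite unmet_diag subr_ge0 agree_le1.
rewrite /= ss' mul1r -[X in X - _](pair_op_const 1 s s') -pair_opB.
exact: ler_pair_op.
Qed.

(** Union bound over the possible meeting times 0 to [m]. *)
Lemma unmet_ge1Bsum_agree m s s' :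
  1 - \sum_(j < m.+1) agree K j s s' <= unmet K m s s'.
Proof.
elim: m s s' => [|m IH] s s'.
  rewrite big_ord1 /agree /= mulr1; case: eqP => _ /=; lra.
have [->|ss'] := eqVneq s s'.
  (* On the diagonal the term of time 0 is already 1, so the left side is at most 0. *)
  rewrite unmet_diag subr_le0 big_ord_recl /= eqxx lerDl.
  apply: sumr_ge0 => i _; rewrite -(pair_op_const 0 s' s').
  apply: ler_pair_op => t t'; elim: (i : nat) t t' => [|k IHk] t t' //=.
  by rewrite -(pair_op_const 0 t t'); apply: ler_pair_op.
rewrite big_ord_recl [agree K 0 s s']/= (negbTE ss') add0r [leRHS]/= ss' mul1r.
rewrite -[X in X - _](pair_op_const 1 s s') -pair_op_sum -pair_opB.
exact: ler_pair_op.
Qed.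

(** Markov property after [m] steps: whatever the positions then, the pair survives [l] more steps
    with probability at most [q]. *)
Lemma unmetD l m q s s' : (forall t t', unmet K l t t' <= q) ->
  unmet K (m + l) s s' <= q * unmet K m s s'.
Proof.
move=> lq; elim: m s s' => [|m IH] s s'.
  rewrite add0n /= mulr1; have [->|_] := eqVneq s s'; last by rewrite mulr1.
  by rewrite unmet_diag mulr0.
by rewrite addSn /= mulrCA ler_wpM2l // -pair_opZ; apply: ler_pair_op.
Qed.

Lemma unmet_le1 m s s' : unmet K m s s' <= 1.
Proof.
elim: m s s' => [|m IH] s s' /=; first by rewrite mulr1; case: eqP.
have : pair_op K (unmet K m) s s' <= 1.
  by rewrite -[leRHS](pair_op_const 1 s s'); apply: ler_pair_op.
by case: eqP; rewrite ?mul0r ?mul1r.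
Qed.

Lemma unmet_le_expn l q m s s' : 0 <= q -> (forall t t', unmet K l t t' <= q) ->
  unmet K m s s' <= q ^+ (m %/ l).
Proof.
move=> q0 lq; have E j : unmet K (j * l) s s' <= q ^+ j.
  elim: j => [|j IH]; first exact: unmet_le1.
  rewrite mulSn addnC exprS; apply: (le_trans (unmetD _ _ _ lq)).
  exact: ler_wpM2l.
(* The last [m %% l] steps, which do not fill a window, are bounded by the factor 1. *)
apply: le_trans (E _); rewrite {1}(divn_eq m l) -[leRHS]mul1r.
exact/unmetD/unmet_le1.
Qed.

End PairEstimates.

(** * From the law of trajectories to the probabilities of pair events *)

Section WalkLaw.
Context {R : realType} {S : finType} {d} {T : measurableType d}.
Variables (K : S -> S -> R) (Pr : probability T R).
Variable X : nat -> T -> config (S := S).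
Hypothesis hX : coalescing_random_walk K Pr X.

Lemma measurable_walk_pred t (Q : pred (config (S := S))) : (1 <= t)%N ->
  measurable [set w | Q (X t w)]%classic.
Proof.
move=> t1; rewrite [X in measurable X](_ : _ =
    \bigcup_(x in [set x | Q x]) [set w | X t w = x])%classic; last first.
  by apply/seteqP; split=> w /= => [Qw|[x Qx ->//]]; exists (X t w).
by apply: fin_bigcup_measurable => [|x _]; [exact: finite_finset|exact: hX.1].
Qed.

Lemma measurable_path (F : nat -> pred (config (S := S))) m k
    (x : nat -> config) : (1 <= k)%N ->
  measurable [set w | (forall t, (1 <= t <= k)%N -> X t w = x t) /\
                      (forall j, (j <= m)%N -> F j (X (k + j)%N w))]%classic.
Proof.
move=> k1; apply: measurableI.
  apply: (@bigcap_measurableType _ _ (fun t => [set w | X t w = x t]%classic)).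
  by move=> t /= /andP[t1 _]; exact: hX.1.
apply: (@bigcap_measurableType _ _ (fun j => [set w | F j (X (k + j)%N w)]%classic)).
by move=> j _; apply: measurable_walk_pred; rewrite addn_gt0 k1.
Qed.

(** This is the Markov property at time [k], derived from the finite-dimensional laws alone:
    induction on [m] splits the event according to the configuration at time [k.+1]. *)
Lemma walk_path_law (F : nat -> pred (config (S := S))) m k
    (x : nat -> config) : (1 <= k)%N ->
  Pr [set w | (forall t, (1 <= t <= k)%N -> X t w = x t) /\
              (forall j, (j <= m)%N -> F j (X (k + j)%N w))]%classic =
  ((x 1%N == [ffun a => a])%:R *
    \prod_(1 <= t < k) coalescing_step K (x t) (x t.+1) *
    path_weight K F m (x k))%:E.
Proof.
elim: m F k x => [|m IH] F k x k1 /=.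
  have [Fk|nFk] := boolP (F 0%N (x k)).
    rewrite mulr1 -hX.2 //; congr (Pr _); apply/seteqP; split=> w /=; first by case.
    move=> Xx; split=> // j; rewrite leqn0 => /eqP ->.
    by rewrite addn0 Xx // k1 leqnn.
  rewrite mulr0 (_ : [set w | _]%classic = set0) ?measure0 //.
  apply/seteqP; split=> w //= -[Xx /(_ 0%N isT)].
  by rewrite addn0 Xx ?k1 ?leqnn // (negbTE nFk).
have [Fk|nFk] := boolP (F 0%N (x k)); last first.
  rewrite mul0r mulr0 (_ : [set w | _]%classic = set0) ?measure0 //.
  apply/seteqP; split=> w //= -[Xx /(_ 0%N isT)].
  by rewrite addn0 Xx ?k1 ?leqnn // (negbTE nFk).
(* [x' y] prolongs the prescribed trajectory by the configuration [y] at time [k.+1]. *)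
pose x' y t := if (t <= k)%N then x t else y.
pose A y := [set w | (forall t, (1 <= t <= k.+1)%N -> X t w = x' y t) /\
              (forall j, (j <= m)%N -> F j.+1 (X (k.+1 + j)%N w))]%classic.
rewrite (_ : [set w | _]%classic = (\bigcup_(y in [set` index_enum _]) A y)%classic);
    last first.
  apply/seteqP; split=> w /=.
    move=> [Xx XF]; exists (X k.+1 w); first by rewrite /= mem_index_enum.
    split=> [t /andP[t1 tk]|j jm]; last by rewrite addSnnS; exact: XF.
    rewrite /x'; case: leqP => [{}tk|kt]; first by rewrite Xx // t1.
    by congr (X _ w); apply/eqP; rewrite eqn_leq tk.
  move=> [y _ [Xx XF]]; split=> [t /andP[t1 tk]|[|j] jm].
  - by rewrite Xx /x' ?tk // t1 ltnW.
  - by rewrite addn0 Xx ?k1 ?leqnSn // /x' leqnn.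
  - by rewrite -addSnnS; exact: XF.
rewrite measure_fin_bigcup; first last.
- by move=> y _; apply: (@measurable_path (fun j => F j.+1) m k.+1 (x' y)).
- move=> y z _ _ [w [[yw _] [zw _]]].
  have := yw k.+1; rewrite zw ?leqnn // /x' ltnn => /(_ isT) ->.
  by [].
- exact: finite_finset.
rewrite -fsbig_seq ?index_enum_uniq //.
have AE y : Pr (A y) = _ := IH (fun j => F j.+1) k.+1 (x' y) isT.
rewrite (eq_bigr _ (fun y _ => AE y)).
rewrite sumEFin mul1r mulr_sumr; congr (_%:E); apply: eq_bigr => y _.
rewrite /x' k1 ltnn big_nat_recr //= leqnn ltnn !mulrA; congr (_ * _ * _ * _).
apply: eq_big_nat => t /andP[_ tk].
by rewrite tk ltnW.
Qed.

(** Step [j] is time [j.+1], since times start at 1. Keeping [F] general covers both a test of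
    separation at every time and a test at the last time only. *)
Lemma walk_unmet_law (F : nat -> pred (config (S := S))) (a b : S) m :
  stochastic K ->
  (forall y : config, F m y = (y a != y b)) ->
  (forall j (y : config), (j < m)%N -> y a != y b -> F j y) ->
  Pr [set w | forall j, (j <= m)%N -> F j (X j.+1 w)]%classic =
  (unmet K m a b)%:E.
Proof.
move=> hK Fm Fj; pose i := [ffun a => a] : config (S := S).
have start : Pr [set w | X 1%N w = i]%classic = 1%:E.
  have := hX.2 1%N (fun=> i) isT; rewrite big_geq // eqxx mulr1 => <-.
  congr (Pr _); apply/seteqP; split=> w /=.
    by move=> X1 t; rewrite -eqn_leq => /eqP <-.
  by move=> /(_ 1%N isT).
have := walk_path_law F m (fun=> i) (leqnn 1).
rewrite big_geq // eqxx !mul1r (path_weight_unmet hK _ Fm Fj) !ffunE => <-.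
have mF : measurable [set w | forall j, (j <= m)%N -> F j (X j.+1 w)]%classic.
  apply: (@bigcap_measurableType _ _ (fun j => [set w | F j (X j.+1 w)]%classic)).
  by move=> j _; apply: measurable_walk_pred.
have m1 : measurable [set w | X 1%N w = i]%classic by exact: hX.1.
(* The walk starts from the identity configuration only almost surely; the exceptional null set is
   discarded. *)
have c0 : Pr (~` [set w | X 1%N w = i]%classic)%classic = 0%E.
  by rewrite probability_setC // start subee.
set B := (X in Pr X = _); set C := (X in _ = Pr X).
have -> : C = (B `&` [set w | X 1%N w = i])%classic.
  apply/seteqP; split=> w /=.
    by move=> [X1 FX]; split; [exact: FX|exact: X1].
  by move=> [FX X1]; split=> // t; rewrite -eqn_leq => /eqP <-.
rewrite (measureDI Pr mF m1) [X in (X + _)%E](_ : _ = 0)%E ?add0e //.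
apply/eqP; rewrite eq_le measure_ge0 andbT -c0 le_measure ?inE //.
- exact: measurableD.
- exact: measurableC.
Qed.

End WalkLaw.

(** * Perron eigenvectors *)

Section Perron.
Context {R : realType} {S : finType}.
Variable K : S -> S -> R.

Definition kernel_op (f : S -> R) (s : S) : R := \sum_t K s t * f t.

Hypothesis K0 : forall s t, 0 <= K s t.

Lemma kernel_op_ge0 f : (forall s, 0 <= f s) -> forall s, 0 <= kernel_op f s.
Proof. by move=> f0 s; apply: sumr_ge0 => t _; apply: mulr_ge0. Qed.

Lemma iter_kernel_op_ge0 k f :
  (forall s, 0 <= f s) -> forall s, 0 <= iter k kernel_op f s.
Proof. by move=> f0; elim: k => //= k IH; exact: kernel_op_ge0. Qed.

Lemma iter_kernel_opB k f g s : iter k kernel_op (fun t => f t - g t) s =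
  iter k kernel_op f s - iter k kernel_op g s.
Proof.
elim: k s => //= k IH s; rewrite /kernel_op -sumrB.
by apply: eq_bigr => t _; rewrite IH mulrBr.
Qed.

Lemma iter_kernel_opZ k c f s : iter k kernel_op (fun t => c * f t) s =
  c * iter k kernel_op f s.
Proof.
elim: k s => //= k IH s; rewrite /kernel_op mulr_sumr.
by apply: eq_bigr => t _; rewrite IH mulrCA.
Qed.

Variable k : nat.
Hypothesis k_gt0 : (0 < k)%N.
(** Primitivity of [K], expressed through its action on nonnegative nonzero functions. *)
Hypothesis primK : forall f, (forall s, 0 <= f s) -> (exists s, 0 < f s) ->
  forall s, 0 < iter k kernel_op f s.

(** The pairs [(r, x)] with [x] in the simplex and [r x <= K x] form a nonempty compact set, on
    which the coordinate [r] attains its maximum. *)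
Lemma collatz_wielandt_max (s0 : S) : exists (r : R) (x : S -> R),
  [/\ 0 <= r, forall s, 0 <= x s, \sum_s x s = 1,
      forall s, r * x s <= kernel_op x s &
      forall r' (y : S -> R), 0 <= r' -> (forall s, 0 <= y s) ->
        \sum_s y s = 1 -> (forall s, r' * y s <= kernel_op y s) -> r' <= r].
Proof.
(* A pair is stored as one row vector: coordinate [None] holds [r], coordinate [Some s] holds [x s].
   Summing [r x <= K x] over all states bounds [r] by the sum of all entries of [K], hence by
   [B]. *)
pose J : finType := option S; pose B : R := 1 + \sum_s \sum_t K s t.
have SK0 : 0 <= \sum_s \sum_t K s t by do 2 (apply: sumr_ge0 => ? _).
pose c (i : J) (M : 'rV[R]_#|J|) := M ord0 (enum_rank i).
have cc i : continuous (c i) by exact: coord_continuous.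
pose box := [set M : 'rV[R]_#|J| | forall i, `[0, B]%classic (M ord0 i)]%classic.
have cbox : compact box.
  by apply: (@rV_compact R #|J| (fun=> `[0, B]%classic)) => i;
    exact: segment_compact.
pose simp := [set M | \sum_s c (Some s) M = 1]%classic.
have csum (w : S -> R) : continuous (fun M => \sum_s w s * c (Some s) M).
  move=> M; apply: (@cvg_big R S +%R 0 xpredT (@add_continuous R) _ _
    (index_enum S) (fun s M => w s * c (Some s) M) (fun s => w s * c (Some s) M)).
    exact: nbhs_filter.
  by move=> s _; exact: (cvgM (cvg_cst (w s)) (cc (Some s) M)).
have csimp : closed simp.
  have /continuous_closedP /(_ _ (@closed_eq _ 1)) := csum (fun=> 1).
  by congr closed; apply/seteqP; split=> M /=; under eq_bigr do rewrite mul1r.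
pose sup_sol := (\bigcap_(s in [set: S])
  [set M | 0 <= \sum_t K s t * c (Some t) M - c None M * c (Some s) M])%classic.
have csup : closed sup_sol.
  apply: closed_bigI => s _.
  have /continuous_closedP /(_ _ (@closed_ge _ 0)) // :
    continuous (fun M => \sum_t K s t * c (Some t) M - c None M * c (Some s) M).
  by move=> M; exact: (cvgB (csum (K s) M) (cvgM (cc None M) (cc (Some s) M))).
pose A := (box `&` simp `&` sup_sol)%classic.
have cA : compact A.
  by apply: compact_closedI => //; apply: compact_closedI.
pose mk (r : R) (y : S -> R) : 'rV[R]_#|J| :=
  \row_i (if enum_val i is Some s then y s else r).
have mkE r y i : c i (mk r y) = if i is Some s then y s else r.
  by rewrite /c mxE enum_rankK.
have mkA r y : 0 <= r -> (forall s, 0 <= y s) -> \sum_s y s = 1 ->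
    (forall s, r * y s <= kernel_op y s) -> A (mk r y).
  move=> r0 y0 y1 ry.
  have yle1 s : y s <= 1.
    by rewrite -y1 (bigD1 s) //= lerDl sumr_ge0.
  split; first split.
  - move=> i; rewrite /= in_itv /= -(enum_valK i).
    rewrite -/(c _ _) mkE; case: (enum_val i) => [s|].
      by rewrite y0 (le_trans (yle1 s)) // lerDl.
    rewrite r0 /= (@le_trans _ _ (\sum_s \sum_t K s t)) ?lerDr //.
    rewrite -[leLHS]mulr1 -y1 mulr_sumr; apply: ler_sum => s _.
    apply: le_trans (ry s) _; apply: ler_sum => t _.
    by rewrite -[leRHS]mulr1 ler_wpM2l.
  - by rewrite /simp /= -y1; apply: eq_bigr => s _; rewrite mkE.
  - move=> s _ /=; rewrite !mkE subr_ge0; apply: le_trans (ry s) _.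
    by apply: ler_sum => t _; rewrite mkE.
have [M MA Mmax] : exists2 M, M \in A & forall N, N \in A -> c None N <= c None M.
  apply: compact_EVT_max => //; last exact: continuous_subspaceT.
  exists (mk 0 (fun s => (s == s0)%:R)); apply: mkA => //.
  - by rewrite (bigD1 s0) //= eqxx big1 ?addr0 // => s /negbTE ->.
  - by move=> s; rewrite mul0r; apply: kernel_op_ge0.
move: MA; rewrite inE => -[[Mbox Msimp] Msup].
have M0 i : 0 <= c i M.
  by have := Mbox (enum_rank i); rewrite /= in_itv /= => /andP[].
exists (c None M), (fun s => c (Some s) M); split=> //.
  by move=> s; have := Msup s I; rewrite /= subr_ge0.
move=> r' y r'0 y0 y1 r'y; have := Mmax (mk r' y); rewrite inE mkE; apply.
exact: mkA.
Qed.

(** The maximiser is an eigenvector: if [r x <= K x] were strict at some state, applying [K] another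
    [k] times would make it strict everywhere, and [r] could be increased. *)
Lemma perron_eigenvector (s0 : S) : exists (lam : R) (v : S -> R),
  [/\ 0 < lam, forall s, 0 < v s & forall s, kernel_op v s = lam * v s].
Proof.
have [r [x [r0 x0 x1 rx rmax]]] := collatz_wielandt_max s0.
have [s1 xs1] : exists s, 0 < x s.
  apply/existsP; rewrite -[[exists _, _]]negbK negb_exists.
  apply/negP => /forallP nx.
  have := x1; rewrite big1 => [/esym/eqP|s _]; first by rewrite oner_eq0.
  by apply/eqP; rewrite eq_le x0 leNgt nx.
pose y := iter k kernel_op x.
have y_gt0 s : 0 < y s by apply: primK => //; exists s1.
have eqx s : kernel_op x s = r * x s.
  have [//|] := eqVneq (kernel_op x s) (r * x s); rewrite eq_sym => ne.
  have d_gt0 t : 0 < kernel_op y t - r * y t.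
    have -> : kernel_op y t - r * y t =
        iter k kernel_op (fun t => kernel_op x t - r * x t) t.
      by rewrite iter_kernel_opB iter_kernel_opZ -iterSr.
    apply: primK => [u|]; first by rewrite subr_ge0.
    by exists s; rewrite subr_gt0 lt_neqAle ne rx.
  (* The least relative slack, by which [r] can be raised while [y] stays admissible after
     normalisation. *)
  pose e := \big[Num.min/1]_t ((kernel_op y t - r * y t) / y t).
  have e0 : 0 < e.
    by apply: lt_bigmin => // t _; rewrite divr_gt0.
  have sy0 : 0 < \sum_t y t.
    by rewrite (bigD1 s) //= ltr_pwDl // sumr_ge0 // => t _; exact: ltW.
  suff : r + e <= r by rewrite gerDl leNgt e0.
  apply: (rmax _ (fun t => (\sum_u y u)^-1 * y t)).
  - by rewrite addr_ge0 // ltW.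
  - by move=> t; rewrite mulr_ge0 // ?invr_ge0 ltW.
  - by rewrite -mulr_sumr mulVf // gt_eqF.
  - move=> t; have := iter_kernel_opZ 1 (\sum_u y u)^-1 y t => /= ->.
    rewrite mulrCA ler_wpM2l ?invr_ge0 ?(ltW sy0) //.
    rewrite mulrDl -lerBrDl -ler_pdivlMr //.
    exact: bigmin_le_cond.
(* Since [y] is both positive and equal to [r ^+ k * x], neither [x s] nor [r] can vanish. *)
have yE s : y s = r ^+ k * x s.
  rewrite /y; elim: (k) s => [|j IH] s /=; first by rewrite expr0 mul1r.
  rewrite exprSr -mulrA -eqx /kernel_op mulr_sumr.
  by apply: eq_bigr => t _; rewrite IH mulrCA.
have x_gt0 s : 0 < x s.
  rewrite lt_neqAle x0 andbT eq_sym; apply: contraTneq (y_gt0 s) => xs0.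
  by rewrite yE xs0 mulr0 ltxx.
exists r, x; split=> //; rewrite lt_neqAle r0 andbT eq_sym.
apply: contraTneq (y_gt0 s0) => r_eq0.
by rewrite yE r_eq0 expr0n gtn_eqF // mul0r ltxx.
Qed.

End Perron.

(** * Spectral radius *)

Section SpectralRadius.
Context {R : realType} {S : finType}.
Implicit Types K : S -> S -> R.

Lemma kernel_mx_expE K k f s : iter k (kernel_op K) f s =
  \sum_t (kernel_mx K ^+ k) (enum_rank s) (enum_rank t) * f t.
Proof.
elim: k s => [|k IH] s.
  rewrite expr0 (bigD1 s) //= mxE eqxx mul1r big1 ?addr0 // => t ts.
  by rewrite mxE (inj_eq enum_rank_inj) eq_sym (negbTE ts) mul0r.
rewrite iterS exprS /kernel_op.
under [RHS]eq_bigr do rewrite mxE big_distrl /=.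
rewrite exchange_big (reindex enum_rank) /=; last first.
  by apply: onW_bij; exact: enum_rank_bij.
apply: eq_bigr => u _; rewrite IH mulr_sumr.
by apply: eq_bigr => t _; rewrite mxE !enum_rankK mulrA.
Qed.

Lemma mixing_iter_gt0 K k : (forall i j, 0 < (kernel_mx K ^+ k) i j) ->
  forall f : S -> R, (forall s, 0 <= f s) -> (exists s, 0 < f s) ->
  forall s, 0 < iter k (kernel_op K) f s.
Proof.
move=> Kk f f0 [t ft] s; rewrite kernel_mx_expE (bigD1 t) //=.
rewrite ltr_pwDl ?mulr_gt0 //; apply: sumr_ge0 => u _.
by rewrite mulr_ge0 // ltW.
Qed.

Lemma sumr_gt0E (F : S -> R) : (forall s, 0 <= F s) ->
  (0 < \sum_s F s) = [exists s, 0 < F s].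
Proof.
move=> F0; apply/idP/existsP => [|[s Fs]]; last first.
  by rewrite (bigD1 s) //= ltr_pwDl // sumr_ge0.
rewrite lt_neqAle eq_sym => /andP[/eqP /psumr_neq0P []] // s /andP[_ Fs].
by exists s.
Qed.

(** Squaring the entries preserves their zero pattern, so primitivity passes from [K] to its
    entrywise square. *)
Lemma iter_kernel_op_sqr_gt0 K k f : (forall s t, 0 <= K s t) ->
  (forall s, 0 <= f s) -> forall s,
  (0 < iter k (kernel_op (fun s t => K s t ^+ 2)) f s) =
  (0 < iter k (kernel_op K) f s).
Proof.
move=> K0 f0; have Q0 s t : 0 <= K s t ^+ 2 by rewrite exprn_ge0.
have pos K' j : (forall s t, 0 <= K' s t) ->
    forall s, 0 <= iter j (kernel_op K') f s.
  by move=> K'0; exact: iter_kernel_op_ge0.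
have opE K' g s : kernel_op K' g s = \sum_t K' s t * g t by [].
elim: k => //= k IH s; rewrite !opE !sumr_gt0E => [|t|t].
- apply: eq_existsb => t; by rewrite !mulr_ge0_gt0 ?pos ?K0 ?mulr_ge0 // IH // andbb.
- by rewrite mulr_ge0 ?pos.
- by rewrite mulr_ge0 ?pos.
Qed.

Lemma normc_sum (I : Type) (r : seq I) (z : I -> R[i]) :
  ComplexField.Normc.normc (\sum_(i <- r) z i) <=
  \sum_(i <- r) ComplexField.Normc.normc (z i).
Proof.
elim/big_ind2: _ => // [|x a y b xa yb].
  by rewrite ComplexField.Normc.normc0.
exact: le_trans (le_normcD _ _) (lerD xa yb).
Qed.

Lemma normc_real (a : R) : ComplexField.Normc.normc (real_complex R a) = `|a|.
Proof. by rewrite /ComplexField.Normc.normc /= expr0n addr0 sqrtr_sqr. Qed.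

(* Pairing a left eigenvector with a positive right eigenvector bounds the
   modulus of every eigenvalue. *)
Lemma spectral_radius_perron K lam (v : S -> R) (s0 : S) :
  (forall s t, 0 <= K s t) -> (forall s, 0 < v s) -> 0 <= lam ->
  (forall s, kernel_op K v s = lam * v s) ->
  spectral_radius (kernel_mx K) = lam.
Proof.
move=> K0 v0 lam0 Kv; set A := kernel_mx K.
have Alam : eigenvalue A lam.
  (* [eigenvalue] refers to left eigenvectors whereas [v] is a right one; the determinant, invariant
     under transposition, links the two. *)
  have : \det (A - lam%:M) == 0.
    rewrite -det_tr; apply/det0P; exists (\row_i v (enum_val i)).
      apply/eqP => /rowP /(_ (enum_rank s0)); rewrite !mxE enum_rankK => v_eq0.
      by have := v0 s0; rewrite v_eq0 ltxx.
    apply/rowP => i; rewrite !mxE (reindex enum_rank) /=; last first.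
      by apply: onW_bij; exact: enum_rank_bij.
    rewrite (eq_bigr (fun t => K (enum_val i) t * v t -
        (if i == enum_rank t then lam * v t else 0))); last first.
      move=> t _; rewrite !mxE enum_rankK mulrBr mulrC; congr (_ - _).
      by case: eqP => _; rewrite ?mulr0 // mulrC.
    rewrite sumrB -/(kernel_op K v _) Kv -big_mkcond /=.
    rewrite (big_pred1 (enum_val i)) ?subrr // => t /=.
    by rewrite -(can2_eq enum_valK enum_rankK).
  move/det0P => [w w0 wA]; apply/eigenvalueP; exists w => //.
  by apply/eqP; rewrite -subr_eq0 -mul_mx_scalar -mulmxBr wA.
rewrite /spectral_radius; set E := (X in sup X).
have Elam : E lam.
  exists (real_complex R lam); first by rewrite /= eigenvalue_map.
  by rewrite normc_real ger0_norm.
have Eub : ubound E lam.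
  move=> _ [z /= /eigenvalueP [w wA w0] <-].
  pose n i := ComplexField.Normc.normc (w ord0 (enum_rank i)).
  have n0 i : 0 <= n i.
    by rewrite /n /ComplexField.Normc.normc; case: (w _ _) => a b; exact: sqrtr_ge0.
  have [s ns] : exists s, 0 < n s.
    apply/existsP; apply: contraNT w0 => /existsPn nn; apply/eqP/rowP => i.
    rewrite mxE; apply: ComplexField.Normc.eq0_normc; apply/eqP.
    by have := nn (enum_val i); rewrite /n enum_valK -leNgt eq_le => ->;
      rewrite -{1}(enum_valK i) n0.
  have step t : ComplexField.Normc.normc z * n t <= \sum_s n s * K s t.
    rewrite -ComplexField.Normc.normcM.
    have -> : z * w ord0 (enum_rank t) =
        \sum_s w ord0 (enum_rank s) * real_complex R (K s t).
      have /rowP /(_ (enum_rank t)) := wA; rewrite !mxE => <-.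
      rewrite (reindex enum_rank) /=; last first.
        by apply: onW_bij; exact: enum_rank_bij.
      by apply: eq_bigr => u _; rewrite !mxE !enum_rankK.
    apply: le_trans (normc_sum _ _) _; apply: ler_sum => u _.
    rewrite ComplexField.Normc.normcM ler_wpM2l //; first exact: n0.
    by rewrite normc_real ger0_norm.
  have nv0 : 0 < \sum_t n t * v t.
    rewrite sumr_gt0E => [|t]; last by rewrite mulr_ge0 // ltW.
    by apply/existsP; exists s; rewrite mulr_gt0.
  rewrite -(ler_pM2r nv0) mulr_sumr [leRHS]mulr_sumr.
  apply: (@le_trans _ _ (\sum_t \sum_s n s * K s t * v t)).
    apply: ler_sum => t _; rewrite mulrA -mulr_suml ler_wpM2r //.
    exact: ltW.
  rewrite exchange_big; apply: ler_sum => u _ /=.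
  rewrite mulrCA -Kv mulr_sumr le_eqVlt; apply/predU1l.
  by apply: eq_bigr => t _; rewrite mulrA.
apply/eqP; rewrite eq_le ub_le_sup ?ge_sup //; first by exists lam.
by exists lam.
Qed.

End SpectralRadius.

(** * Stationary law, Perron data and meeting of letters for a mixing chain *)

Section MixingChain.
Context {R : realType} {V : finType}.
Variables (P : V -> V -> R) (p : V -> R).
Hypotheses (hP : stochastic P) (hmix : mixing P) (hp : stationary P p).

Lemma stationary_iter k f :
  \sum_u p u * iter k (kernel_op P) f u = \sum_u p u * f u.
Proof.
elim: k => //= k IH; rewrite -IH.
under eq_bigr do rewrite /kernel_op mulr_sumr.
rewrite exchange_big /=; apply: eq_bigr => u _.
under eq_bigr do rewrite mulrA.
by rewrite -mulr_suml; case: hp => _ _ ->.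
Qed.

Lemma stationary_gt0 u : 0 < p u.
Proof.
have [p0 p1 _] := hp; have [k _ Pk] := hmix.
have [x px] : exists x, 0 < p x.
  by apply/existsP; rewrite -sumr_gt0E // p1.
have -> : p u = \sum_x p x * (x == u)%:R.
  by rewrite (bigD1 u) //= eqxx mulr1 big1 ?addr0 // => y /negbTE ->; rewrite mulr0.
rewrite -(stationary_iter k) sumr_gt0E => [|y].
  apply/existsP; exists x; rewrite mulr_gt0 //; apply: (mixing_iter_gt0 Pk) => //.
  by exists u; rewrite eqxx.
by rewrite mulr_ge0 //; apply: iter_kernel_op_ge0 => //; exact: hP.1.
Qed.

Lemma stationary_pred v : exists u, 0 < P u v.
Proof.
have [p0 p1 pP] := hp; have := stationary_gt0 v; rewrite -pP sumr_gt0E => [|y].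
  move=> /existsP[u]; rewrite mulr_ge0_gt0 ?hP.1 // => /andP[_ ?].
  by exists u.
by rewrite mulr_ge0 ?hP.1.
Qed.

Lemma kernel_le1 u v : P u v <= 1.
Proof. by rewrite -(hP.2 u) (bigD1 v) //= lerDl sumr_ge0 // => *; exact: hP.1. Qed.

(** The last clause serves the early tail over a one-letter alphabet, where no two words have
    distinct last letters. *)
Lemma perron_square : exists (lam : R) (v : V -> R),
  [/\ 0 < lam <= 1, lam = spectral_radius (kernel_mx (fun u w => P u w ^+ 2)),
      forall u, 0 < v u,
      forall u, \sum_w P u w ^+ 2 * v w = lam * v u &
      (forall x y : V, x = y) -> lam = 1].
Proof.
have [k k0 Pk] := hmix; have [p0 p1 _] := hp.
have [x0 _] : exists x, 0 < p x.
  by apply/existsP; rewrite -sumr_gt0E // p1.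
have Q0 u w : 0 <= P u w ^+ 2 by rewrite exprn_ge0 // hP.1.
have primQ f : (forall s, 0 <= f s) -> (exists s, 0 < f s) -> forall s,
    0 < iter k (kernel_op (fun u w => P u w ^+ 2)) f s.
  by move=> f0 fs s; rewrite iter_kernel_op_sqr_gt0 //;
    [exact: mixing_iter_gt0|exact: hP.1].
have [lam [v [lam0 v0 Qv]]] := perron_eigenvector Q0 k0 primQ x0.
exists lam, v; split=> //.
- rewrite lam0 /=.
  (* At a maximum [m] of [v], bounding [P ^+ 2] by [P] and [v] by [v m] gives [lam * v m <= v m]. *)
  case: (@Order.TotalTheory.arg_maxP _ _ V x0 xpredT v isT) => m _ vm.
  rewrite -(ler_pM2r (v0 m)) -Qv mul1r -[leRHS]mul1r -(hP.2 m) mulr_suml.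
  apply: ler_sum => w _; apply: (@le_trans _ _ (P m w * v w)).
    by rewrite ler_wpM2r ?(ltW (v0 w)) // expr2 ler_piMl ?kernel_le1 //; exact: hP.1.
  by rewrite ler_wpM2l //; [exact: hP.1|exact: vm].
- by rewrite (spectral_radius_perron x0 Q0 v0 (ltW lam0)).
- move=> V1; apply: (mulIf (lt0r_neq0 (v0 x0))).
  have P1 : P x0 x0 = 1.
    by rewrite -(hP.2 x0) (big_pred1 x0) // => y /=; rewrite (V1 y x0) eqxx.
  rewrite -Qv /kernel_op (big_pred1 x0) ?P1 ?expr1n // => y /=.
  by rewrite (V1 y x0) eqxx.
Qed.

Lemma agree_letters_gt0 : exists (k : nat) (c : R), 0 < c /\
  forall x y, c <= agree P k x y.
Proof.
have [k _ Pk] := hmix; have [p0 p1 _] := hp.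
have [z _] : exists x, 0 < p x.
  by apply/existsP; rewrite -sumr_gt0E // p1.
(* [g x] is the probability of being at the fixed letter [z] after [k] steps from [x]; two
   independent chains agree at least when both are at [z]. *)
pose f t : R := (t == z)%:R; pose g x := iter k (kernel_op P) f x.
have g0 x : 0 < g x.
  by apply: (mixing_iter_gt0 Pk) => //; exists z; rewrite /f eqxx.
have fg x y : g x * g y <= agree P k x y.
  rewrite /g /agree; elim: (k) x y => [|j IH] x y /=.
    by rewrite /f; case: (eqVneq x z) => [->|]; rewrite ?mul0r // mul1r eq_sym.
  rewrite {1}/kernel_op mulr_suml; apply: ler_sum => t _.
  rewrite mulr_sumr; apply: ler_sum => t' _.
  by rewrite mulrACA ler_wpM2l ?mulr_ge0 ?hP.1.
exists k, (\big[Num.min/1]_x g x * \big[Num.min/1]_x g x); split.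
  by rewrite mulr_gt0 //; apply: lt_bigmin => // x _; exact: g0.
move=> x y; apply: le_trans (fg x y).
have b0 : 0 <= \big[Num.min/1]_x g x.
  by apply: le_bigmin => // u _; exact: ltW.
by apply: ler_pM => //; exact: bigmin_le_cond.
Qed.

End MixingChain.

(** * Block chains *)

Section BlockChain.
Context {R : realType} {V : finType}.
Variables (P : V -> V -> R) (p : V -> R).
Hypotheses (hP : stochastic P) (p_gt0 : forall x, 0 < p x).
Variables (n : nat) (x0 : V).
Hypothesis n_gt0 : (0 < n)%N.

Definition word (u : block P p n) : seq V := tval (val u).

Local Notation K := (block_kernel (P := P) (p := p) (n := n)).
Local Notation shift w z := (rcons (behead w) z).

Lemma size_word u : size (word u) = n.
Proof. exact: size_tuple. Qed.

Lemma word_inj : injective word.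
Proof. by move=> u v uv; do 2 apply: val_inj. Qed.

Lemma word_cons u : exists x s, word u = x :: s.
Proof.
have := size_word u; case: (word u) => [/= n0|x s _]; last by exists x, s.
by move: n_gt0; rewrite -n0.
Qed.

Lemma pairmap_prod_ge0 x s : 0 <= \prod_(q <- pairmap P x s) q.
Proof.
elim: s x => [|y s IH] x /=; first by rewrite big_nil.
by rewrite big_cons mulr_ge0 ?hP.1.
Qed.

Lemma mu_gt0E x s : (0 < mu P p (x :: s)) = (0 < \prod_(q <- pairmap P x s) q).
Proof. by rewrite /= pmulr_rgt0. Qed.

Lemma mu_shift_gt0 u z : 0 < P (last x0 (word u)) z ->
  0 < mu P p (shift (word u) z).
Proof.
have := valP u; rewrite -/(word u); have [x [s ->]] := word_cons u.
rewrite mu_gt0E /=; case: s => [|y s] /=; first by rewrite big_nil mulr1 p_gt0.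
rewrite big_cons mulr_ge0_gt0 ?hP.1 ?pairmap_prod_ge0 // => /andP[_ s_gt0] z_gt0.
rewrite pmulr_rgt0 // -cats1 pairmap_cat big_cat /= big_seq1.
by rewrite mulr_gt0.
Qed.

(** For each letter [z], the only possible successor of [u] ending in [z] is its shift. The shift
    has positive measure when [z] has positive transition probability; otherwise both sides
    vanish. *)
Lemma sum_block_kernel u (phi : seq V -> R) :
  \sum_v K u v * phi (word v) =
  \sum_z P (last x0 (word u)) z * phi (shift (word u) z).
Proof.
rewrite (partition_big (fun v => last x0 (word v)) xpredT) //=.
apply: eq_bigr => z _; have [x [s us]] := word_cons u.
have K_neq0 v : last x0 (word v) = z -> K u v != 0 ->
    word v = shift (word u) z /\ K u v = P (last x0 (word u)) z.
  have [y [t vt]] := word_cons v; rewrite /block_kernel -!/(word _) us vt /=.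
  have [-> <- _|_ _] := eqVneq s (belast y t); last by rewrite eqxx.
  by rewrite -lastI.
have [z_gt0|z_le0] := ltP 0 (P (last x0 (word u)) z); last first.
  have z0 : P (last x0 (word u)) z = 0.
    by apply/eqP; rewrite eq_le z_le0 hP.1.
  rewrite z0 mul0r big1 // => v /eqP vz; apply/eqP; rewrite mulf_eq0.
  have [//|Kuv] := eqVneq (K u v) 0.
  by have [_ e] := K_neq0 v vz Kuv; rewrite e z0 eqxx in Kuv.
have sz : size (shift (word u) z) == n.
  by rewrite size_rcons size_behead size_word prednK.
pose v : block P p n := Sub (Tuple sz) (mu_shift_gt0 z_gt0).
have vw : word v = shift (word u) z by [].
have vz : last x0 (word v) = z by rewrite vw last_rcons.
rewrite (bigD1 v) /=; last by rewrite vz.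
rewrite vw big1 ?addr0 => [|v' /andP[/eqP v'z v'v]]; last first.
  apply/eqP; rewrite mulf_eq0; have [//|/(K_neq0 _ v'z)[v'w _]] := eqVneq (K u v') 0.
  by case/eqP: v'v; apply: word_inj; rewrite v'w vw.
congr (_ * _); rewrite /block_kernel -!/(word _) vw us /=.
have e : rcons s z = head z (rcons s z) :: behead (rcons s z) by case: (s).
have := e; rewrite lastI => /rcons_inj [es ez].
by rewrite e -es eqxx -ez.
Qed.

Lemma block_kernel_stochastic : stochastic K.
Proof.
split=> [u v|u].
  rewrite /block_kernel; case: (tval _) => // x s; case: (tval _) => // y t.
  by case: ifP => // _; exact: hP.1.
have := sum_block_kernel u (fun=> 1); under eq_bigr do rewrite mulr1.
by move=> ->; under eq_bigr do rewrite mulr1; exact: hP.2.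
Qed.

Lemma pair_op_block (phi : seq V -> seq V -> R) u v :
  pair_op K (fun u v => phi (word u) (word v)) u v =
  pair_op P (fun z z' => phi (shift (word u) z) (shift (word v) z'))
    (last x0 (word u)) (last x0 (word v)).
Proof.
rewrite /pair_op; transitivity (\sum_u' K u u' *
    \sum_z' P (last x0 (word v)) z' * phi (word u') (shift (word v) z')).
  apply: eq_bigr => u' _; rewrite -sum_block_kernel mulr_sumr.
  by apply: eq_bigr => v' _; rewrite mulrA.
rewrite (sum_block_kernel u (fun w =>
  \sum_z' P (last x0 (word v)) z' * phi w (shift (word v) z'))).
apply: eq_bigr => z _; rewrite mulr_sumr.
by apply: eq_bigr => z' _; rewrite mulrA.
Qed.

Variables (lam vmin vmax : R) (v : V -> R).
Hypotheses (lam_gt0 : 0 < lam) (vmin_gt0 : 0 < vmin).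
Hypothesis v_bounds : forall x, vmin <= v x <= vmax.
Hypothesis Pv : forall x, \sum_z P x z ^+ 2 * v z = lam * v x.

Let v_ge0 x : 0 <= v x.
Proof. by have /andP[vx _] := v_bounds x; rewrite ltW // (lt_le_trans vmin_gt0). Qed.

Let vmax_gt0 : 0 < vmax.
Proof.
by have /andP[vx] := v_bounds x0; apply: lt_le_trans; apply: lt_le_trans vx.
Qed.

(** The condition under which [m] common new letters make two words equal, together with equality of
    the current last letters. For words of length [n] the second test is implied by the first when
    [m < n], and is all that remains at [m = n]. *)
Definition same_tail m (w w' : seq V) :=
  (drop m w == drop m w') && (last x0 w == last x0 w').

Lemma same_tail_shift m u u' z z' : (m < n)%N ->
  same_tail m (shift (word u) z) (shift (word u') z') =
  (drop m.+1 (word u) == drop m.+1 (word u')) && (z == z').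
Proof.
move=> mn; have E u1 z1 : drop m (shift (word u1) z1) =
    rcons (drop m.+1 (word u1)) z1.
  rewrite drop_rcons ?size_behead ?size_word; last lia.
  by have [x [s ->]] := word_cons u1.
by rewrite /same_tail !E !last_rcons eqseq_rcons -andbA andbb.
Qed.

(** Both words append the same letter [z] with probability [P x z ^+ 2], where [x] is their common
    last letter; the eigenvector equation then yields the factor [lam]. *)
Lemma pair_op_same_tail m c u u' : (m < n)%N ->
  last x0 (word u) = last x0 (word u') ->
  pair_op K (fun u u' => (same_tail m (word u) (word u'))%:R *
                         (c * v (last x0 (word u)))) u u' =
  (same_tail m.+1 (word u) (word u'))%:R * (c * lam * v (last x0 (word u))).
Proof.
move=> mn luu'; rewrite (pair_op_block (fun w w' => (same_tail m w w')%:R *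
                         (c * v (last x0 w)))) /pair_op -luu'.
rewrite {2}/same_tail luu' eqxx andbT -luu' -mulrA -Pv !mulr_sumr.
apply: eq_bigr => z _; rewrite (bigD1 z) //= [X in _ + X]big1 ?addr0.
  by rewrite same_tail_shift // eqxx andbT last_rcons; ring.
move=> z' zz'; rewrite same_tail_shift // [z == z']eq_sym (negbTE zz').
by rewrite andbF mul0r mulr0.
Qed.

(** Since [m.+1 < n], the differing letters are still in the words after [m.+1] steps, so they
    prevent agreement. *)
Lemma pair_op_same_tail0 m c u u' : (m.+1 < n)%N ->
  last x0 (word u) != last x0 (word u') ->
  pair_op K (fun u u' => (same_tail m (word u) (word u'))%:R *
                         (c * v (last x0 (word u)))) u u' = 0.
Proof.
move=> mn luu'; rewrite (pair_op_block (fun w w' => (same_tail m w w')%:R *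
                         (c * v (last x0 w)))) /pair_op.
rewrite big1 // => z _; rewrite big1 // => z' _.
rewrite same_tail_shift ?(ltnW mn) //; case: eqP => [e|]; last by rewrite mul0r mulr0.
case/eqP: luu'; rewrite -(cat_take_drop m.+1 (word u)).
rewrite -(cat_take_drop m.+1 (word u')) e.
rewrite !last_cat; have : (0 < size (drop m.+1 (word u')))%N.
  by rewrite size_drop size_word subn_gt0.
by case: (drop _ _).
Qed.

(** The eigenvector supplies a bound that one step multiplies exactly by [lam]; dividing by [vmin]
    makes it at least 1 when the words are equal at time 0. *)
Lemma agree_block_le m u u' : (m < n)%N -> agree K m u u' <=
  (same_tail m (word u) (word u'))%:R * (vmin^-1 * lam ^+ m * v (last x0 (word u))).
Proof.
elim: m u u' => [|m IH] u u' mn.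
  rewrite /agree /= /same_tail !drop0 expr0 mulr1 (inj_eq word_inj).
  case: eqP => [->|_]; last by rewrite mul0r.
  rewrite eqxx !mul1r mulrC ler_pdivlMr // mul1r.
  by case/andP: (v_bounds (last x0 (word u'))).
apply: (@le_trans _ _ (pair_op K (fun u u' => (same_tail m (word u) (word u'))%:R *
    (vmin^-1 * lam ^+ m * v (last x0 (word u)))) u u')).
  apply: ler_pair_op; first exact: block_kernel_stochastic.
  by move=> t t'; apply: IH; exact: ltnW.
have [e|ne] := eqVneq (last x0 (word u)) (last x0 (word u')).
  by rewrite pair_op_same_tail ?(ltnW mn) // exprSr (mulrA vmin^-1).
by rewrite pair_op_same_tail0 // !mulr_ge0 ?invr_ge0 ?exprn_ge0 ?(ltW lam_gt0)
    ?(ltW vmin_gt0) ?(ltW vmax_gt0).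
Qed.

(** Only the last [n.-1] steps are used: the bound there is uniform in the words, so averaging over
    the first [j] steps keeps it. *)
Lemma agree_block_le_late j u u' :
  agree K (j + n.-1) u u' <= lam ^+ n.-1 * (vmax / vmin).
Proof.
elim: j u u' => [|j IH] u u'.
  rewrite add0n; apply: le_trans (agree_block_le _ _ _) _; first by rewrite prednK.
  have -> : lam ^+ n.-1 * (vmax / vmin) = vmin^-1 * lam ^+ n.-1 * vmax by ring.
  have c0 : 0 <= vmin^-1 * lam ^+ n.-1.
    by rewrite !mulr_ge0 ?invr_ge0 ?exprn_ge0 ?(ltW lam_gt0)
    ?(ltW vmin_gt0).
  have /andP[_ vm] := v_bounds (last x0 (word u)).
  case: same_tail; rewrite ?mul1r ?mul0r; first exact: ler_wpM2l.
  by rewrite mulr_ge0 // ltW.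
rewrite addSn -[leRHS](pair_op_const block_kernel_stochastic _ u u').
by apply: ler_pair_op => //; exact: block_kernel_stochastic.
Qed.

Lemma agree_block_le_distinct m u u' :
  last x0 (word u) != last x0 (word u') ->
  agree K m u u' <= lam ^+ n.-1 * (vmax / vmin).
Proof.
move=> luu'; have [mn|nm] := ltnP m n; last first.
  by rewrite -(subnK (leq_trans (leq_pred n) nm)) agree_block_le_late.
apply: le_trans (agree_block_le _ _ mn) _.
rewrite /same_tail (negbTE luu') andbF mul0r.
by rewrite !mulr_ge0 ?invr_ge0 ?exprn_ge0 ?(ltW lam_gt0)
    ?(ltW vmin_gt0) ?(ltW vmax_gt0).
Qed.

Lemma agree_block_ge m u u' : (m <= n)%N ->
  (same_tail m (word u) (word u'))%:R * (vmax^-1 * lam ^+ m * v (last x0 (word u)))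
  <= agree K m u u'.
Proof.
elim: m u u' => [|m IH] u u' mn.
  rewrite /agree /= /same_tail !drop0 expr0 mulr1 (inj_eq word_inj).
  case: eqP => [->|_]; last by rewrite mul0r.
  rewrite eqxx !mul1r mulrC ler_pdivrMr // mul1r.
  by case/andP: (v_bounds (last x0 (word u'))).
apply: (@le_trans _ _ (pair_op K (fun u u' => (same_tail m (word u) (word u'))%:R *
    (vmax^-1 * lam ^+ m * v (last x0 (word u)))) u u')); last first.
  apply: ler_pair_op; first exact: block_kernel_stochastic.
  by move=> t t'; apply: IH; exact: ltnW.
have [e|ne] := eqVneq (last x0 (word u)) (last x0 (word u')).
  by rewrite pair_op_same_tail // exprSr (mulrA vmax^-1).
rewrite {1}/same_tail (negbTE ne) andbF mul0r.
rewrite -(pair_op_const block_kernel_stochastic 0 u u').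
apply: ler_pair_op; first exact: block_kernel_stochastic.
by move=> t t'; rewrite !mulr_ge0 ?invr_ge0 ?exprn_ge0 ?(ltW lam_gt0)
    ?(ltW vmin_gt0) ?(ltW vmax_gt0).
Qed.

(** The last letters evolve as [P]-chains: they agree after [i] steps, and [n] common letters then
    fill both words. *)
Lemma agree_block_ge_letters i u u' :
  agree P i (last x0 (word u)) (last x0 (word u')) * (lam ^+ n * (vmin / vmax))
  <= agree K (i + n) u u'.
Proof.
set c := lam ^+ n * _; have c0 : 0 <= c.
  by rewrite !mulr_ge0 ?invr_ge0 ?exprn_ge0 ?(ltW lam_gt0)
    ?(ltW vmin_gt0) ?(ltW vmax_gt0).
elim: i u u' => [|i IH] u u'.
  rewrite add0n; apply: le_trans (agree_block_ge _ _ (leqnn n)).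
  rewrite /same_tail !drop_oversize ?size_word // eqxx /= /agree /=.
  case: eqP => _ /=; last by rewrite !mul0r.
  rewrite !mul1r /c [vmin / _]mulrC mulrCA mulrA.
  rewrite ler_wpM2l ?mulr_ge0 ?invr_ge0 ?exprn_ge0 ?(ltW lam_gt0)
    ?(ltW vmin_gt0) ?(ltW vmax_gt0) //.
  by case/andP: (v_bounds (last x0 (word u))).
apply: (@le_trans _ _ (pair_op K (fun u u' =>
    c * agree P i (last x0 (word u)) (last x0 (word u'))) u u')); last first.
  apply: ler_pair_op; first exact: block_kernel_stochastic.
  by move=> t t'; rewrite mulrC; apply: IH.
rewrite (pair_op_block (fun w w' => c * agree P i (last x0 w) (last x0 w'))).
rewrite pair_opZ mulrC ler_wpM2l // le_eqVlt; apply/predU1l.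
by apply: eq_bigr => z _; apply: eq_bigr => z' _; rewrite !last_rcons.
Qed.

End BlockChain.

(** Start from the one-letter word and extend it to the left by predecessors of positive transition
    probability. *)
Lemma block_ending_in (R : realType) (V : finType) (P : V -> V -> R) (p : V -> R)
    n x0 (x : V) :
  stochastic P -> (forall x, 0 < p x) -> (forall y, exists z, 0 < P z y) ->
  (0 < n)%N -> exists u : block P p n, last x0 (word u) = x.
Proof.
move=> hP p0 predP; case: n => // n _.
have [w [wn w0 wx]] : exists w, [/\ size w = n.+1, 0 < mu P p w & last x0 w = x].
  elim: n => [|n [[|y s] [//= [sn] y0 sx]]].
    by exists [:: x]; split; rewrite // mu_gt0E // big_nil.
  have [z Pzy] := predP y; exists [:: z, y & s]; split; rewrite /= ?sn //.
  rewrite mulr_gt0 // big_cons mulr_gt0 //.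
  by move: y0; rewrite -/(mu P p (y :: s)) mu_gt0E.
move/eqP: wn => wn; exists (Sub (Tuple wn) w0); exact: wx.
Qed.

(** * Coalescence time *)

Lemma card_codom1P {S : finType} (s0 : S) (x : config (S := S)) :
  reflect (forall a b, x a = x b) (#|codom x| == 1%N).
Proof.
apply: (iffP idP) => [/eqP x1 a b|xab].
  have /card_le1_eqP x1' : (#|codom x| <= 1)%N by rewrite x1.
  by apply: x1'; exact: codom_f.
rewrite eqn_leq; apply/andP; split.
  by apply/card_le1_eqP => _ _ /codomP[a ->] /codomP[b ->]; exact: xab.
by apply/card_gt0P; exists (x s0); exact: codom_f.
Qed.

Section CoalescenceProbability.
Context {R : realType} {S : finType} {d} {T : measurableType d}.
Variables (K : S -> S -> R) (Pr : probability T R) (s0 : S).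
Variable X : nat -> T -> config (S := S).
Hypotheses (hK : stochastic K) (hX : coalescing_random_walk K Pr X).

Lemma measurable_coalesced_at (I : nat -> Prop) :
  (forall t, I t -> (1 <= t)%N) ->
  measurable [set w | exists t, I t /\ #|codom (X t w)| = 1%N]%classic.
Proof.
move=> I1; rewrite [X in measurable X](_ : _ =
    \bigcup_(t in I) [set w | #|codom (X t w)| == 1%N])%classic; last first.
  apply/seteqP; split=> w /= [t]; first by move=> [It /eqP X1]; exists t.
  by move=> It /eqP X1; exists t.
apply: bigcup_measurable => t It.
by apply: (measurable_walk_pred hX (fun x => #|codom x| == 1%N)); exact: I1.
Qed.

(** Union bound over all pairs of walkers, time [t] being step [t.-1]. *)
Lemma prob_not_coalesced t r : (1 <= t)%N ->
  (forall a b, unmet K t.-1 a b <= r) ->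
  (Pr [set w | #|codom (X t w)| != 1%N]%classic <= (#|S|%:R ^+ 2 * r)%:E)%E.
Proof.
move=> t1 ur.
pose A (ab : S * S) := [set w | X t w ab.1 != X t w ab.2]%classic.
have mA ab : measurable (A ab).
  exact: (measurable_walk_pred hX (fun x => x ab.1 != x ab.2)).
have PA ab : Pr (A ab) = (unmet K t.-1 ab.1 ab.2)%:E.
  (* The test is vacuous before the last step, so the event concerns time [t] alone. *)
  pose F j := [pred x : config (S := S) | (j == t.-1) ==> (x ab.1 != x ab.2)].
  rewrite -(walk_unmet_law hX (F := F) hK) /F //=; first last.
  - by move=> j y jt _; rewrite ltn_eqF.
  - by move=> y; rewrite eqxx.
  congr (Pr _); apply/seteqP; split=> w /=.
    by move=> Aw j _; apply/implyP => /eqP ->; rewrite prednK.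
  by move=> /(_ _ (leqnn _)); rewrite eqxx prednK.
apply: (@le_trans _ _ (\sum_(ab : S * S) Pr (A ab))%E).
  rewrite fsbig_seq ?index_enum_uniq //; apply: content_sub_fsum.
  - exact: finite_finset.
  - by move=> ab _; exact: mA.
  - exact: (measurable_walk_pred hX (fun x => #|codom x| != 1%N)).
  - move=> w /= nc.
    have [[a b] ab] : exists ab : S * S, X t w ab.1 != X t w ab.2.
      apply/existsP; apply: contraNT nc => /existsPn xab.
      apply/(card_codom1P s0) => a b; apply/eqP.
      by have := xab (a, b); rewrite negbK.
    by exists (a, b) => //=; rewrite mem_index_enum.
under eq_bigr do rewrite PA.
rewrite sumEFin lee_fin; apply: (@le_trans _ _ (\sum_(ab : S * S) r)).
  by apply: ler_sum => ab _; exact: ur.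
by rewrite sumr_const card_prod expr2 -natrM mulr_natl.
Qed.

(** Full coalescence forces the two walkers started at [a] and [b] to have met. *)
Lemma prob_coalesced_by M a b :
  (Pr [set w | exists t, (1 <= t <= M)%N /\ #|codom (X t w)| = 1%N]%classic <=
   (\sum_(j < M) agree K j a b)%:E)%E.
Proof.
case: M => [|m].
  rewrite big_ord0 (_ : [set w | _]%classic = set0) ?measure0 //.
  by apply/seteqP; split=> w //= -[[|t] []].
pose B := [set w | forall j, (j <= m)%N -> X j.+1 w a != X j.+1 w b]%classic.
have mB : measurable B.
  apply: (@bigcap_measurableType _ _
    (fun j => [set w | X j.+1 w a != X j.+1 w b]%classic)) => j _.
  exact: (measurable_walk_pred hX (fun x => x a != x b)).
have PB : Pr B = (unmet K m a b)%:E.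
  by apply: (walk_unmet_law hX
    (F := fun _ => [pred x : config (S := S) | x a != x b])).
apply: (@le_trans _ _ (Pr (~` B)%classic)).
  apply: le_measure; rewrite ?inE.
  - apply: (@measurable_coalesced_at (fun t => 1 <= t <= m.+1)%N) => t.
    by case/andP.
  - exact: measurableC.
  move=> w /= [[|t] [// /andP[_ tm] /eqP /(card_codom1P s0) xab]] /(_ t tm).
  by rewrite (xab a b) eqxx.
rewrite probability_setC // PB -EFinB lee_fin.
by have := unmet_ge1Bsum_agree hK m a b; lra.
Qed.

End CoalescenceProbability.

Lemma coalescence_time_spec {R : realType} {S : finType} {T : Type}
    (X : nat -> T -> config (S := S)) (w : T) :
  (exists t, [/\ (1 <= t)%N, #|codom (X t w)| = 1%N,
      forall t', (1 <= t')%N -> #|codom (X t' w)| = 1%N -> (t <= t')%N &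
      coalescence_time X w = t%:R%:E :> \bar R]) \/
  ((forall t, (1 <= t)%N -> #|codom (X t w)| <> 1%N) /\
   coalescence_time X w = +oo%E :> \bar R).
Proof.
have [ex|nex] := pselect (exists t, (1 <= t)%N && (#|codom (X t w)| == 1%N)).
  left; have [t /andP[t1 /eqP xt] tmin] := ex_minnP ex.
  have tmin' t' : (1 <= t')%N -> #|codom (X t' w)| = 1%N -> (t <= t')%N.
    by move=> t'1 /eqP xt'; apply: tmin; rewrite t'1.
  exists t; split=> //; apply/eqP; rewrite eq_le; apply/andP; split.
    by apply: ereal_inf_lbound; exists t.
  apply: le_ereal_inf_tmp => _ [t' [t'1 xt'] <-].
  by rewrite lee_fin ler_nat; exact: tmin'.
right; have nx t : (1 <= t)%N -> #|codom (X t w)| <> 1%N.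
  by move=> t1 xt; apply: nex; exists t; rewrite t1 xt.
split=> //; rewrite /coalescence_time.
rewrite (_ : [set _ | _ in _]%classic = set0) ?ereal_inf0 //.
by apply/seteqP; split=> x //= -[t [t1 /(nx _ t1)]].
Qed.

(** Exponentiating turns the deviation into a late event and an early event. An infinite coalescence
    time has infinite deviation and belongs to the late one. *)
Lemma deviation_eventE {R : realType} {S : finType} {T : Type}
    (X : nat -> T -> config (S := S)) (n : nat) (eps L : R) : (1 <= n)%N ->
  [set w | (eps%:E <
     `| (n%:R^-1)%:E * lne (coalescence_time X w) - L%:E |)%E]%classic =
  ([set w | forall t, (1 <= t)%N /\ t%:R <= expR (n%:R * (L + eps)) ->
              #|codom (X t w)| != 1%N] `|`
   [set w | exists t, ((1 <= t)%N /\ t%:R < expR (n%:R * (L - eps))) /\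
              #|codom (X t w)| = 1%N])%classic.
Proof.
move=> n1; have n0 : 0 < n%:R :> R by rewrite ltr0n.
have ni0 : (0 < (n%:R^-1)%:E :> \bar R)%E by rewrite lte_fin invr_gt0.
have H w : (eps%:E < `|(n%:R^-1)%:E * lne (coalescence_time X w) - L%:E|)%E <->
  (forall t, (1 <= t)%N /\ t%:R <= expR (n%:R * (L + eps)) ->
              #|codom (X t w)| != 1%N) \/
  (exists t, ((1 <= t)%N /\ t%:R < expR (n%:R * (L - eps))) /\
              #|codom (X t w)| = 1%N).
  have [[t [t1 xt tmin ->]]|[nx ->]] := @coalescence_time_spec R S T X w; last first.
    rewrite /= gt0_muley // addye // ltry; split=> // _; left=> t [t1 _].
    by apply/eqP; exact: nx.
  have t0 : 0 < t%:R :> R by rewrite ltr0n.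
  rewrite lne_EFin // -EFinM -EFinB abse_EFin lte_fin.
  have tE a (x : R) : 0 < x -> (expR a < x) = (a < ln x).
    by move=> x0; rewrite -[RHS]ltr_expR lnK ?posrE.
  have tE' a (x : R) : 0 < x -> (x < expR a) = (ln x < a).
    by move=> x0; rewrite -[RHS]ltr_expR lnK ?posrE.
  have -> : (eps < `|n%:R^-1 * ln t%:R - L|) =
      (expR (n%:R * (L + eps)) < t%:R) || (t%:R < expR (n%:R * (L - eps))).
    rewrite tE // tE' // ltr_normr ltrBrDl mulrC ltr_pdivlMr // [_ * n%:R]mulrC.
    by rewrite opprB ltrBrDl -ltrBrDr ltr_pdivrMr // [_ * n%:R]mulrC.
  split=> [/orP[big|small]|[far|[t' [[t'1 small] xt']]]].
  - left=> t' [t'1 le_t']; apply/eqP => /(tmin _ t'1).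
    by rewrite leqNgt -(ltr_nat R) (le_lt_trans le_t' big).
  - by right; exists t.
  - apply/orP; left; rewrite ltNge; apply/negP => le_t.
    by have := far t (conj t1 le_t); rewrite xt.
  - apply/orP; right; apply: le_lt_trans small.
    by rewrite ler_nat; exact: tmin.
by apply/seteqP; split=> w /H.
Qed.

Lemma card_block_le {R : realType} {V : finType} (P : V -> V -> R) (p : V -> R) n :
  #|block P p n|%:R <= expR (n%:R * #|V|%:R) :> R.
Proof.
rewrite expRM_natl (@le_trans _ _ ((#|V|%:R : R) ^+ n)) //.
  rewrite -natrX ler_nat -[(_ ^ _)%N](card_tuple n V).
  by apply: (leq_card val); exact: val_inj.
rewrite lerXn2r ?nnegrE ?expR_ge0 ?ler0n //.
by apply: le_trans (expR_ge1Dx _); rewrite lerDr.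
Qed.

(** * Asymptotics *)

Section Asymptotics.
Context {R : realType}.
Implicit Types c lam eps a : R.

Lemma expR_natM_lnB n lam eps : 0 < lam ->
  expR (n%:R * (- ln lam + eps)) * lam ^+ n = expR (n%:R * eps).
Proof.
move=> lam0; rewrite mulrDr expRD mulrAC (expRM_natl n (- ln lam)) expRN.
rewrite lnK ?posrE //.
by rewrite -exprMn mulVf ?gt_eqF // expr1n mul1r.
Qed.

Lemma nat_above (x : R) : exists N, forall n : nat, (N <= n)%N -> x <= n%:R.
Proof.
exists (Num.truncn x).+1 => n Nn; apply: ltW; apply: lt_le_trans (truncnS_gt x) _.
by rewrite ler_nat.
Qed.

Lemma expRBN1_le (x : R) : expR (x - 1) <= expR x / 2.
Proof.
rewrite expRD expRN ler_wpM2l ?expR_ge0 // lef_pV2 ?posrE ?expR_gt0 //.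
by apply: le_trans (expR_ge1Dx 1); lra.
Qed.

(* [expR (n a) ^ 2] bounds the number of pairs of walkers; each pair has
   [M.-1 %/ (k + n)] independent chances to meet, each succeeding with
   probability at least [c lam ^ n]. *)
Lemma late_tail_asymptotics c lam eps a k :
  0 < c -> 0 < lam <= 1 -> 0 < eps -> 0 <= a ->
  exists N, forall n : nat, (1 <= n)%N -> (N <= n)%N ->
  expR (n%:R * a) ^+ 2 * expR (- (c * lam ^+ n)) ^+
    ((Num.truncn (expR (n%:R * (- ln lam + eps)))).-1 %/ (k + n)) <=
  expR (- (eps / 2) * n%:R) / 2.
Proof.
move=> c0 /andP[lam0 lam1] eps0 a0.
(* The exponent needed per letter: [2 * a] for the pairs, [eps / 2] for the target rate, [2 * c] for
   rounding, and 1 for the final factor 1/2. *)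
pose G := 2 * a + eps / 2 + 2 * c + 1.
have G0 : 0 < G by rewrite /G; lra.
(* [N] makes the cubic term of the exponential [E] dominate the quadratic quantity [G * n * l]. *)
have [N HN] := nat_above (6 * G * k.+1%:R / (c * eps ^+ 3)).
exists N => n n1 Nn; set T1 := expR (n%:R * (- ln lam + eps)).
set M := Num.truncn T1.
set l := (k + n)%N; set j := (_ %/ l)%N.
have n0 : 1 <= n%:R :> R by rewrite ler1n.
have l0 : (0 < l)%N by rewrite /l; lia.
have l1 : 1 <= l%:R :> R by rewrite ler1n.
have lk : l%:R <= k.+1%:R * n%:R :> R by rewrite -natrM ler_nat /l; nia.
have M1 : (M <= j.+1 * l)%N.
  have : (M.-1 < j.+1 * l)%N := ltn_ceil M.-1 l0.
  by case: (M).
have T1M : T1 <= (j%:R + 1) * l%:R + 1.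
  have T1M : T1 < M.+1%:R by exact: truncnS_gt.
  apply: le_trans (ltW T1M) _.
  by rewrite -natr1 lerD2r natr1 -natrM ler_nat.
have lamn0 : 0 < lam ^+ n by rewrite exprn_gt0.
have lamn1 : lam ^+ n <= 1 by rewrite exprn_ile1 // ltW.
have TE : T1 * lam ^+ n = expR (n%:R * eps) by exact: expR_natM_lnB.
set E := expR (n%:R * eps) in TE.
have E3 : (n%:R * eps) ^+ 3 / 6 <= E.
  have ne0 : 0 <= n%:R * eps by rewrite mulr_ge0 // ltW.
  by have := expR_ge1Dxn 2 ne0; rewrite -/E (_ : 3`! = 6)%N //; lra.
have EG : G * n%:R * l%:R <= c * E.
  have := HN n Nn; rewrite ler_pdivrMr; last by rewrite mulr_gt0 // exprn_gt0.
  move=> nG; apply: (@le_trans _ _ (c * ((n%:R * eps) ^+ 3 / 6))); last first.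
    by rewrite ler_wpM2l // ltW.
  apply: (@le_trans _ _ (G * n%:R * (k.+1%:R * n%:R))).
    by rewrite ler_wpM2l // mulr_ge0 // ltW.
  have -> : c * ((n%:R * eps) ^+ 3 / 6) = (n%:R * (c * eps ^+ 3)) * n%:R ^+ 2 / 6.
    by field.
  have -> : G * n%:R * (k.+1%:R * n%:R) = (6 * G * k.+1%:R) * n%:R ^+ 2 / 6.
    by field.
  by rewrite ler_wpM2r ?invr_ge0 // ler_wpM2r // exprn_ge0.
(* The two roundings, of [T1] and of the quotient [j], cost at most [2 * l], as
   [lam ^+ n <= 1 <= l]. *)
have Ej : E <= (lam ^+ n * j%:R + 2) * l%:R.
  rewrite -TE; apply: le_trans (ler_wpM2r (ltW lamn0) T1M) _.
  have : lam ^+ n * l%:R <= 1 * l%:R by rewrite ler_wpM2r.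
  have -> : ((j%:R + 1) * l%:R + 1) * lam ^+ n =
    lam ^+ n * j%:R * l%:R + lam ^+ n * l%:R + lam ^+ n by ring.
  lra.
have key : G * n%:R <= c * (lam ^+ n * j%:R + 2).
  have l0' : 0 < l%:R :> R by rewrite ltr0n.
  rewrite -(ler_pM2r l0'); apply: le_trans EG _.
  by rewrite -mulrA ler_wpM2l // ltW.
rewrite -!expRM_natl -expRD; apply: le_trans (expRBN1_le _).
rewrite ler_expR.
have : 2 * c + 1 <= (2 * c + 1) * n%:R by rewrite ler_peMr //; lra.
move: key; rewrite /G; lra.
Qed.

(** The product equals [C / lam] times an exponential of rate [eps]; half of that rate absorbs the
    constant. *)
Lemma early_tail_asymptotics C lam eps : 0 <= C -> 0 < lam -> 0 < eps ->
  exists N, forall n : nat, (1 <= n)%N -> (N <= n)%N ->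
  expR (n%:R * (- ln lam - eps)) * (lam ^+ n.-1 * C) <=
  expR (- (eps / 2) * n%:R) / 2.
Proof.
move=> C0 lam0 eps0; have [N HN] := nat_above (4 * C / (lam * eps)).
exists N => n n1 Nn.
have -> : expR (n%:R * (- ln lam - eps)) * (lam ^+ n.-1 * C) =
    expR (n%:R * - eps) * (C / lam).
  have lamn : lam ^+ n = lam ^+ n.-1 * lam by rewrite -exprSr prednK.
  rewrite -(expR_natM_lnB n (- eps) lam0) lamn.
  by field; rewrite gt_eqF.
have -> : n%:R * - eps = - (eps / 2) * n%:R + - (eps / 2) * n%:R by field.
rewrite expRD -mulrA ler_wpM2l ?expR_ge0 //.
have -> : - (eps / 2) * n%:R = - (eps / 2 * n%:R) by rewrite mulNr.
rewrite expRN mulrC ler_pdivrMr ?expR_gt0 //.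
have := HN n Nn; rewrite ler_pdivrMr ?mulr_gt0 // => nC.
have : C / lam <= n%:R * eps / 4.
  by rewrite ler_pdivrMr //; lra.
have := expR_ge1Dx (eps / 2 * n%:R); lra.
Qed.

End Asymptotics.

(** * Combination of the late and early tails *)

Theorem theorem1p1 (R : realType) (V : finType) (P : V -> V -> R) (p : V -> R)
    (hP : stochastic P) (hmix : mixing P) (hp : stationary P p)
    (eps : R) (heps : 0 < eps) :
  exists (delta : R) (N : nat), 0 < delta /\
    forall n : nat, (1 <= n)%N -> (N <= n)%N ->
    forall (d : measure_display) (T : measurableType d)
      (Pr : probability T R) (X : nat -> T -> config (S := block P p n)),
      coalescing_random_walk (block_kernel (P := P) (p := p) (n := n)) Pr X ->
      (Pr [set w | eps%:E <
            `| (n%:R^-1)%:E * lne (coalescence_time X w) - (Lexp P)%:E | ]%classic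
        <= (expR (- delta * n%:R))%:E)%E.
Proof.
have p0 := stationary_gt0 hP hmix hp.
have [k [c [c0 kc]]] := agree_letters_gt0 hP hmix hp.
have [lam [v [lam01 lamE v0 Qv V1]]] := perron_square hP hmix hp.
have /andP[lam0 lam1] := lam01.
have [x0 _] : exists x, 0 < p x.
  by have [pge p1 _] := hp; apply/existsP; rewrite -sumr_gt0E // p1.
pose vmin := \big[Num.min/v x0]_x v x; pose vmax := \big[Num.max/v x0]_x v x.
have vmin0 : 0 < vmin by apply: lt_bigmin.
have vb x : vmin <= v x <= vmax by rewrite bigmin_le_cond // le_bigmax_cond.
have vmax0 : 0 < vmax by have /andP[_] := vb x0; exact: lt_le_trans.
have c1_gt0 : 0 < c * (vmin / vmax) by rewrite mulr_gt0 // divr_gt0.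
have [N1 H1] := late_tail_asymptotics k c1_gt0 lam01 heps (ler0n R #|V|).
have [N2 H2] := early_tail_asymptotics (ltW (divr_gt0 vmax0 vmin0)) lam0 heps.
(* Each tail contributes half of the bound at rate [eps / 2]. *)
exists (eps / 2), (maxn N1 N2); split; first by rewrite divr_gt0.
move=> n n1; rewrite geq_max => /andP[nN1 nN2] d T Pr X hX.
have hK := block_kernel_stochastic hP p0 x0 n1.
have endP x := block_ending_in x0 x hP p0 (stationary_pred hP hmix hp) n1.
have [u0 _] := endP x0.
rewrite (_ : Lexp P = - ln lam); last by rewrite lamE.
rewrite deviation_eventE //.
set T1 := expR (n%:R * (- ln lam + eps)); set T2 := expR _.
set U := [set w | forall t, _]%classic; set D := [set w | exists t, _]%classic.
have mU : measurable U.
  apply: (@bigcap_measurableType _ _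
    (fun t => [set w | #|codom (X t w)| != 1%N]%classic)) => t /= [t1 _].
  exact: (measurable_walk_pred hX (fun x => #|codom x| != 1%N)).
have mle M : measurable
    [set w | exists t, (1 <= t <= M)%N /\ #|codom (X t w)| = 1%N]%classic.
  by apply: (measurable_coalesced_at hX (I := fun t => 1 <= t <= M)%N) => t /andP[].
have mD : measurable D.
  by apply: (measurable_coalesced_at hX) => t [].
have PU : (Pr U <= (expR (- (eps / 2) * n%:R) / 2)%:E)%E.
  pose M := Num.truncn T1.
  (* As [lam <= 1], the threshold is at least 1, so its integer part [M] is a genuine time. *)
  have T1_ge1 : 1 <= T1.
    rewrite -[1]expR0 ler_expR mulr_ge0 // addr_ge0 ?(ltW heps) //.
    by rewrite oppr_ge0 ln_le0.
  have M1 : (1 <= M)%N by rewrite truncn_gt0.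
  (* By [1 - x <= expR (- x)], [q] bounds the probability that a pair stays apart during a window of
     [k + n] steps. *)
  pose q := expR (- (c * (vmin / vmax) * lam ^+ n)).
  have uq a b : unmet (block_kernel (P := P) (p := p) (n := n)) M.-1 a b <=
      q ^+ (M.-1 %/ (k + n)).
    apply: unmet_le_expn => // [|t t']; first exact: expR_ge0.
    apply: le_trans (unmet_le1Bagree hK _ _ _) _.
    apply: le_trans (expR_ge1Dx _); rewrite lerD2l lerN2.
    apply: le_trans (agree_block_ge_letters hP p0 x0 n1 lam0 vmin0 vb Qv k t t').
    rewrite -mulrA [_ * lam ^+ n]mulrC ler_wpM2r ?kc //.
    by rewrite mulr_ge0 ?exprn_ge0 ?divr_ge0 ?ltW.
  apply: le_trans (le_trans (prob_not_coalesced u0 hK hX M1 uq) _).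
    apply: le_measure; rewrite ?inE //.
      exact: (measurable_walk_pred hX (fun x => #|codom x| != 1%N)).
    by move=> w; apply; split=> //; rewrite truncn_le (le_trans ler01).
  rewrite lee_fin; apply: le_trans (H1 n n1 nN1); rewrite ler_wpM2r //.
    by rewrite exprn_ge0 // expR_ge0.
  by rewrite lerXn2r ?nnegrE ?expR_ge0 // card_block_le.
have PD : (Pr D <= (expR (- (eps / 2) * n%:R) / 2)%:E)%E.
  have T20 : 0 <= T2 by exact: expR_ge0.
  pose M := Num.truncn T2.
  have DM : (D `<=`
      [set w | exists t, (1 <= t <= M)%N /\ #|codom (X t w)| = 1%N])%classic.
    by move=> w [t [[t1 tT] xt]]; exists t; rewrite t1 truncn_ge_nat // ltW.
  apply: (@le_trans _ _ _ _ _ (le_measure Pr _ _ DM)); rewrite ?inE //.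
  have [[x [y xy]]|all_eq] := pselect (exists x y : V, x != y).
    have [a ax] := endP x; have [b bx] := endP y.
    apply: le_trans (prob_coalesced_by u0 hK hX M a b) _; rewrite lee_fin.
    apply: le_trans (H2 n n1 nN2).
    apply: (@le_trans _ _ (\sum_(j < M) lam ^+ n.-1 * (vmax / vmin))).
      apply: ler_sum => j _.
      apply: (agree_block_le_distinct hP p0 n1 lam0 vmin0 vb Qv (x0 := x0)).
      by rewrite ax bx.
    rewrite sumr_const card_ord -[leLHS]mulr_natl ler_wpM2r //.
      by rewrite mulr_ge0 ?exprn_ge0 ?divr_ge0 ?ltW.
    by rewrite truncn_le.
  (* With a single letter the threshold [T2] is below 1, so no time precedes it and the early event
     is empty. *)
  have lam_eq1 : lam = 1.
    by apply: V1 => x y; apply: contrapT => /eqP xy; apply: all_eq; exists x, y.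
  have M0 : M = 0%N.
    apply/truncn0Pn; rewrite -ltNge -expR0 ltr_expR lam_eq1 ln1 oppr0 sub0r.
    by rewrite mulrN oppr_lt0 mulr_gt0 // ltr0n.
  rewrite (_ : [set w | _]%classic = set0) ?measure0.
    by rewrite lee_fin divr_ge0 // expR_ge0.
  by apply/seteqP; split=> w //= -[t]; rewrite M0 => -[]; case: t.
apply: (@le_trans _ _ (Pr U + Pr D)%E); first exact: measureU2.
have -> : expR (- (eps / 2) * n%:R) =
  expR (- (eps / 2) * n%:R) / 2 + expR (- (eps / 2) * n%:R) / 2 :> R by field.
by rewrite EFinD leeD.
Qed.
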